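(* Let $p=\{p^{[n]}\}_n$ and $q=\{q^{[n]}\}_n$ be two families of probability laws, where for each $n$ both $p^{[n]}$ and $q^{[n]}$ are laws on $\mathcal{X}^n$, either both discrete or both absolutely continuous. Consider the binary hypothesis test in which $(X_1,\dots,X_n)$ is distributed according to $p^{[n]}$ or $q^{[n]}$, and suppose that $D^{[n]} = D(p^{[n]}\|q^{[n]})$ is finite for every $n$. Let $0<\tau<\tfrac12$. For a (measurable) decision region $\mathcal{B}_p\subset\mathcal{X}^n$ for hypothesis $p^{[n]}$, write $\alpha^{[n]} = p^{[n]}(\mathcal{B}_p^c)$ and $\beta^{[n]} = q^{[n]}(\mathcal{B}_p)$, and define $$\beta^{[n]}_\tau = \inf_{\mathcal{B}_p\subset\mathcal{X}^n,\ \alpha^{[n]}<\tau} \beta^{[n]}.$$ Suppose that (i) $D^{[n]}\to\infty$ as $n\to\infty$; and (ii) for every $\xi>0$ there exists a $\tau$-good family $\delta=\{\delta^{[n]}\}_n$ (with $\tau$ regarded as the constant family $\tau^{[n]}=\tau$) such that $\delta^{[n]}<\xi D^{[n]}$ for all $n$ large enough. Then $$-\log\beta^{[n]}_\tau = D^{[n]} + o\left(D^{[n]}\right)\qquad (n\to\infty).$$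
   Context: The logarithm is to base 2 throughout, also in the relative entropy. The laws $p^{[n]}, q^{[n]}$ are identified with their probability mass functions (discrete case) or densities (absolutely continuous case), and $$D^{[n]} = D(p^{[n]}\|q^{[n]}) = \mathrm{E}_{p^{[n]}}\left[\log\frac{p^{[n]}(\mathbf X)}{q^{[n]}(\mathbf X)}\right].$$ No independence of the coordinates is assumed, nor any consistency between different $n$. For a family $\delta=\{\delta^{[n]}\}_n$ of positive scalars, the relative-entropy $\delta$-typical set is $$\mathcal{A}^{[n]}(p,q,\delta)=\left\{\mathbf x\in\mathcal{X}^n: D^{[n]}-\delta^{[n]}\le\log\frac{p^{[n]}(\mathbf x)}{q^{[n]}(\mathbf x)}\le D^{[n]}+\delta^{[n]}\right\}.$$ For a family $\epsilon=\{\epsilon^{[n]}\}_n$ of positive scalars, $\delta$ is said to be $\epsilon$-good if $p^{[n]}\left(\mathcal{A}^{[n]}(p,q,\delta)\right)\ge 1-\epsilon^{[n]}$ for all $n$ large enough. *)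

(* Defs.v *)
From HB Require Import structures.
From mathcomp Require Import all_boot all_order all_algebra.
From mathcomp Require Import all_classical all_reals all_analysis.

Set Implicit Arguments.
Unset Strict Implicit.
Unset Printing Implicit Defensive.
Import Order.TTheory GRing.Theory Num.Theory.
Import numFieldNormedType.Exports.

Local Open Scope classical_set_scope.
Local Open Scope ring_scope.
Local Open Scope ereal_scope.

Lemma product_sigma_finite d1 d2 (T1 : measurableType d1)
    (T2 : measurableType d2) (R : realType)
    (m1 : {sigma_finite_measure set T1 -> \bar R})
    (m2 : {sigma_finite_measure set T2 -> \bar R}) :
  sigma_finite setT (m1 \x m2).
Proof.
have /sigma_finiteP[F [TF ndF Foo]] := sigma_finiteT m1.
have /sigma_finiteP[G [TG ndG Goo]] := sigma_finiteT m2.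
exists (fun n => F n `*` G n).
  rewrite -setXTT TF TG predeqE => -[x y]; split.
    move=> [/= [n _ Fnx] [k _ Gky]]; exists (maxn n k) => //; split.
    - by move: x Fnx; exact/subsetPset/ndF/leq_maxl.
    - by move: y Gky; exact/subsetPset/ndG/leq_maxr.
  by move=> [n _ []/= ? ?]; split; exists n.
move=> k; have [? ?] := Foo k; have [? ?] := Goo k.
split; first exact: measurableX.
by rewrite product_measure1E// lte_mul_pinfty// ge0_fin_numE.
Qed.

Section tuple_power_measure.
Context d (X : measurableType d) (R : realType).
Variable lam : {sigma_finite_measure set X -> \bar R}.

Section cons_measure.
Variables (n : nat) (mu : {sigma_finite_measure set (n.-tuple X) -> \bar R}).

Definition tuple_cons (xt : X * n.-tuple X) : n.+1.-tuple X :=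
  [tuple of xt.1 :: xt.2].

Lemma measurable_tuple_cons : measurable_fun setT tuple_cons.
Proof. exact: measurable_cons. Qed.

Definition cons_measure (A : set (n.+1.-tuple X)) : \bar R :=
  pushforward (lam \x mu) tuple_cons A.

Let cons_measure0 : cons_measure set0 = 0.
Proof. by rewrite /cons_measure /pushforward preimage_set0 measure0. Qed.

Let cons_measure_ge0 A : 0 <= cons_measure A.
Proof. by rewrite /cons_measure /pushforward. Qed.

Let cons_measure_sigma_additive : semi_sigma_additive cons_measure.
Proof.
move=> F mF tF mUF; rewrite /cons_measure /pushforward preimage_bigcup.
apply: measure_semi_sigma_additive.
- by move=> k; rewrite -[X in measurable X]setTI; exact: measurable_tuple_cons.
- apply/trivIsetP => /= i j _ _ ij; rewrite -preimage_setI.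
  by move/trivIsetP : tF => /(_ i j Logic.I Logic.I ij) ->; rewrite preimage_set0.
- rewrite -preimage_bigcup -[X in measurable X]setTI.
  exact: measurable_tuple_cons.
Qed.

HB.instance Definition _ := isMeasure.Build _ _ _ cons_measure
  cons_measure0 cons_measure_ge0 cons_measure_sigma_additive.

Let cons_measure_sigma_finite : sigma_finite setT cons_measure.
Proof.
have [F FT Foo] := product_sigma_finite lam mu.
pose un (t : n.+1.-tuple X) := (tnth t ord0, [tuple of behead t]).
have unK : cancel tuple_cons un.
  by move=> [x t]; congr pair; exact: val_inj.
have consK : cancel un tuple_cons.
  by move=> t; rewrite /tuple_cons /= [RHS]tuple_eta; exact: val_inj.
have mun : measurable_fun setT un.
  apply/measurable_fun_pair; first exact: measurable_tnth.
  exact: measurable_behead.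
exists (fun k => un @^-1` F k).
  by rewrite -preimage_bigcup -FT preimage_setT.
move=> k; have [mF Fk] := Foo k; split.
  by rewrite -[X in measurable X]setTI; exact: mun.
rewrite /cons_measure /pushforward -comp_preimage.
by rewrite (_ : un \o tuple_cons = id)//; apply/funext => z /=; rewrite unK.
Qed.

HB.instance Definition _ := Measure_isSigmaFinite.Build _ _ _ cons_measure
  cons_measure_sigma_finite.

End cons_measure.

(* The n-fold product measure lam^n on X^n; for X = R and lam the Lebesgue
   measure, this is the Lebesgue measure on R^n. *)
Fixpoint power_measure (n : nat) :
    {sigma_finite_measure set (n.-tuple X) -> \bar R} :=
  match n with
  | 0 => \d_([tuple] : 0.-tuple X)
  | m.+1 => cons_measure (power_measure m)
  end.

(* Defining property of the product measure on boxes. *)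
Lemma power_measure_box n (A : 'I_n -> set X) :
  (forall i, measurable (A i)) ->
  power_measure n [set t | forall i, A i (tnth t i)] = \prod_(i < n) lam (A i).
Proof.
elim: n A => [|n IH] A mA.
  rewrite big_ord0 /= diracE.
  by rewrite mem_set//= => -[].
rewrite big_ord_recl -IH => [|i]; last exact: mA.
rewrite /= /cons_measure /pushforward.
rewrite -product_measure1E//; last first.
  rewrite (_ : mkset _ = \bigcap_(i in [set: 'I_n])
      ((@tnth _ X ^~ i) @^-1` A (lift ord0 i))); last first.
    by apply/seteqP; split => [t At i _|t At i]; exact: At.
  apply: fin_bigcap_measurable => // i _.
  by rewrite -[Y in measurable Y]setTI; exact: measurable_tnth.
congr (product_measure1 _ _ _); apply/seteqP; split => [[x t] /= At|[x t] /= [Ax At] i].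
  split; first by have := At ord0.
  by move=> i; have := At (lift ord0 i); rewrite tnthS.
have [->//|i0] := eqVneq i ord0.
by case: (unliftP ord0 i) i0 => [j ->|->]; rewrite ?eqxx// tnthS.
Qed.

End tuple_power_measure.

Section laws.
Context d (T : measurableType d) (R : realType).
Implicit Types (mu : {measure set T -> \bar R}) (P Q : probability T R).
Implicit Types (f g : T -> R).

(* P is a discrete law with probability mass function f; requiring singletons
   to be events makes f x = P {x} meaningful. *)
Definition is_pmf P f :=
  [/\ forall x : T, measurable [set x],
      exists2 C : set T, countable C & P C = 1
    & forall x, (f x)%:E = P [set x]].

Definition is_density mu P f :=
  [/\ measurable_fun setT f,
      forall x, (0 <= f x)%R
    & forall A, measurable A -> P A = \int[mu]_(x in A) (f x)%:E].

(* The laws P and Q are either both discrete or both absolutely continuous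
   with respect to mu, and are identified with the functions f and g. *)
Definition identified mu P Q f g :=
  (is_pmf P f /\ is_pmf Q g) \/ (is_density mu P f /\ is_density mu Q g).

Definition log2 (x : \bar R) : \bar R := lne x * ((ln 2)^-1)%:E.

(* Extended-real-valued: a / 0 = +oo when 0 < a, so the value is +oo where
   f > 0 = g and -oo where f = 0 < g.  Where f = g = 0, which is a null set for
   both laws, the library conventions 0 / 0 = 0 and lne 0 = -oo give -oo. *)
Definition llr f g (x : T) : \bar R := log2 ((f x)%:E / (g x)%:E).

Definition relative_entropy P f g : \bar R := \int[P]_x llr f g x.

Definition typical_set f g (D delta : R) : set T :=
  [set x | (D - delta)%:E <= llr f g x <= (D + delta)%:E].

(* A decision region B is an event in favour of P; the two error
   probabilities are P (~` B) and Q B. *)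
Definition optimal_type2_error P Q (tau : R) : \bar R :=
  ereal_inf [set Q B | B in [set B | measurable B /\ P (~` B) < tau%:E]].

End laws.

(* For a family of laws P n on spaces T n and of sets A n depending on a
   parameter delta n. *)
Definition good (R : realType) d (T : nat -> measurableType d)
    (P : forall n, probability (T n) R)
    (A : forall n, R -> set (T n)) (eps delta : nat -> R) : Prop :=
  \forall n \near \oo, (1 - eps n)%:E <= P n (A n (delta n)).

(* Main.v *)
(** Comparing P and Q through the log-likelihood ratio L on the typical set
    bounds the optimal type-II error from both sides.  An admissible region meets
    the typical set with P-probability at least 1 - 2 tau, and there
    p <= 2^(D + delta) q, hence beta >= 2^-(D + delta) (1 - 2 tau).  Conversely
    {L >= D - delta / tau} is admissible and q <= 2^-(D - delta / tau) p on it,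
    hence beta <= 2^-(D - delta / tau).  Since tau is fixed, delta = o(D) makes
    both bounds D + o(D) on the logarithmic scale. *)

Require Import Defs.
From mathcomp Require Import all_boot all_order all_algebra.
From mathcomp Require Import all_classical all_reals all_analysis.
From mathcomp Require Import measurable_realfun.
From mathcomp Require Import lra.
Set Implicit Arguments.
Unset Strict Implicit.
Unset Printing Implicit Defensive.
Import Order.TTheory GRing.Theory Num.Theory.
Import numFieldNormedType.Exports.
Local Open Scope classical_set_scope.
Local Open Scope ring_scope.

(** * Base-2 logarithms and pointwise thresholds of the likelihood ratio *)

Lemma log2_EFin (R : realType) (a : R) :
  0 < a -> log2 a%:E = (ln a / ln 2)%:E.
Proof. by move=> a0; rewrite /log2 lne_EFin. Qed.

Lemma ln2_gt0 (R : realType) : 0 < ln 2 :> R.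
Proof. by rewrite ln_gt0// ltr1n. Qed.

Lemma ler_log2 (R : realType) (s a : R) :
  0 < a -> (s <= ln a / ln 2) = (2 `^ s <= a).
Proof.
move=> a0; rewrite ler_pdivlMr ?ln2_gt0// -ln_powR ler_ln ?posrE ?powR_gt0//.
Qed.

Lemma log2_ler (R : realType) (s a : R) :
  0 < a -> (ln a / ln 2 <= s) = (a <= 2 `^ s).
Proof.
move=> a0; rewrite ler_pdivrMr ?ln2_gt0// -ln_powR ler_ln ?posrE ?powR_gt0//.
Qed.

Section likelihood_ratio.
Context d (T : measurableType d) (R : realType).
Implicit Types (P Q : probability T R) (f g : T -> R).
Implicit Types mu : {measure set T -> \bar R}.

Lemma llrE f g x : 0 <= f x -> 0 <= g x ->
  llr f g x = if f x == 0 then -oo%E else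
              if g x == 0 then +oo%E else (ln (f x / g x) / ln 2)%:E.
Proof.
move=> f0 g0; rewrite /llr.
have Vln2 : 0 < (ln 2)^-1 :> R by rewrite invr_gt0 ln2_gt0.
have [->|fx0] := eqVneq (f x) 0.
  by rewrite mul0e /log2 le0_lneNy// gt0_mulNye// lte_fin.
have fp : 0 < f x by rewrite lt_neqAle eq_sym fx0.
have [->|gx0] := eqVneq (g x) 0.
  by rewrite inve0 gt0_muley ?lte_fin// /log2 /= gt0_mulye// lte_fin.
have gp : 0 < g x by rewrite lt_neqAle eq_sym gx0.
by rewrite inver (negbTE gx0) -EFinM log2_EFin// divr_gt0.
Qed.

(** Clearing the denominator also covers [g x = 0 < f x], where the ratio is [+oo]. The conjunct
    [0 < f x] rules out [f x = g x = 0], where the inequality between [f] and [g] holds although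
    [llr] is [-oo]. *)
Lemma le_llr f g (s : R) x : 0 <= f x -> 0 <= g x ->
  (s%:E <= llr f g x)%E = (0 < f x) && (2 `^ s * g x <= f x).
Proof.
move=> f0 g0; rewrite llrE// (lt_neqAle 0) f0 andbT eq_sym.
have [->|fx0] := eqVneq (f x) 0; first by rewrite leeNy_eq.
have [->|gx0] := eqVneq (g x) 0; first by rewrite mulr0 f0 leey.
have gp : 0 < g x by rewrite lt_neqAle eq_sym gx0.
have fp : 0 < f x by rewrite lt_neqAle eq_sym fx0.
by rewrite lee_fin ler_log2 ?divr_gt0// ler_pdivlMr.
Qed.

Lemma llr_le f g (s : R) x : 0 <= f x -> 0 <= g x ->
  (llr f g x <= s%:E)%E -> f x <= 2 `^ s * g x.
Proof.
move=> f0 g0; rewrite llrE//.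
have [->|fx0] := eqVneq (f x) 0; first by rewrite mulr_ge0// powR_ge0.
have [->|gx0] := eqVneq (g x) 0; first by rewrite leye_eq.
have gp : 0 < g x by rewrite lt_neqAle eq_sym gx0.
have fp : 0 < f x by rewrite lt_neqAle eq_sym fx0.
by rewrite lee_fin log2_ler ?divr_gt0// ler_pdivrMr.
Qed.

(** * From pointwise bounds on [f] and [g] to bounds between [P] and [Q] *)

Lemma is_pmf_ge0 P f x : is_pmf P f -> 0 <= f x.
Proof. by case=> _ _ Pf; rewrite -lee_fin Pf. Qed.

Lemma identified_ge0 mu P Q f g : identified mu P Q f g ->
  (forall x, 0 <= f x) /\ (forall x, 0 <= g x).
Proof.
case=> [[Pf Qg]|[[_ f0 _] [_ g0 _]]]; last by split.
by split=> x; [exact: is_pmf_ge0 Pf|exact: is_pmf_ge0 Qg].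
Qed.

Lemma identifiedC mu P Q f g : identified mu P Q f g -> identified mu Q P g f.
Proof. by case=> -[? ?]; [left|right]. Qed.

Lemma is_pmf_countable_support P f : is_pmf P f -> countable [set x | 0 < f x].
Proof.
case=> m1 [C cC PC1] Pf; apply: (sub_countable _ cC); apply: subset_card_le.
move=> x /= fx; apply: contrapT => Cx.
have mC : measurable C by exact: countable_measurable.
have : (P [set x] <= P (~` C))%E.
  by apply: le_measure; rewrite ?inE; [exact: m1|exact: measurableC|move=> y ->].
by rewrite probability_setC// PC1 subee// -Pf lee_fin leNgt fx.
Qed.

(** Restricting [B] to a countable carrier [C] of [P] costs no [P]-mass and can only decrease the
    [Q]-mass, so one carrier is enough. On [B] intersected with [C] the bound is summed point by
    point. *)
Lemma is_pmf_measure_le P Q f g (c : R) (B : set T) : 0 <= c ->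
  is_pmf P f -> is_pmf Q g -> measurable B ->
  (forall x, B x -> f x <= c * g x) -> (P B <= c%:E * Q B)%E.
Proof.
move=> c0 [m1 [C cC PC1] Pf] [_ _ Qg] mB fg.
have mC : measurable C by exact: countable_measurable.
have mBC : measurable (B `&` C) by exact: measurableI.
have PB : (P B <= P (B `&` C))%E.
  rewrite -[leRHS]adde0 -[X in (_ + X)%E](_ : P (~` C) = 0%E); last first.
    by rewrite probability_setC// PC1 subee.
  apply: (@le_trans _ _ (P ((B `&` C) `|` ~` C))).
    apply: le_measure; rewrite ?inE//.
      by apply: measurableU => //; exact: measurableC.
    by move=> x Bx; have [Cx|Cx] := pselect (C x); [left|right].
  by apply: measureU2 => //; exact: measurableC.
have QB : (Q (B `&` C) <= Q B)%E.
  by apply: le_measure; rewrite ?inE//; exact: subIsetl.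
apply: (le_trans PB); apply: (@le_trans _ _ (c%:E * Q (B `&` C))%E); last first.
  by rewrite lee_wpmul2l ?lee_fin.
have /countable_injP[h hinj] := cC.
(* The injection [h] into the naturals cuts the set into slices with at most one point each, ready
   for countable additivity. *)
pose F i := (B `&` C) `&` [set x | h x = i].
have F01 i : F i = set0 \/ exists2 x, B x & F i = [set x].
  have [->|/set0P[x Fx]] := eqVneq (F i) set0; first by left.
  right; exists x; first by case: Fx => -[].
  case: Fx => -[Bx Cx] hx; apply/seteqP; split => [y [[By Cy] hy]|y ->//].
  by apply: hinj; rewrite ?inE//= hx hy.
have mF i : measurable (F i) by case: (F01 i) => [->|[x _ ->]].
have tF : trivIset setT F.
  apply/trivIsetP => i j _ _ /eqP ij; apply/seteqP; split => // x [] [_ hi] [_ hj].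
  by apply: ij; rewrite -hi.
have PQF i : (P (F i) <= c%:E * Q (F i))%E.
  case: (F01 i) => [->|[x Bx ->]]; first by rewrite !measure0 mule0.
  by rewrite -Pf -Qg -EFinM lee_fin fg.
have BCE : B `&` C = \bigcup_i F i.
  by apply/seteqP; split => [x BCx|x [i _ []]//]; exists (h x).
rewrite BCE !measure_bigcup// -nneseriesZl//.
apply: lee_nneseries => // i _; exact: PQF.
Qed.

Lemma is_density_measure_le mu P Q f g (c : R) (B : set T) : 0 <= c ->
  is_density mu P f -> is_density mu Q g -> measurable B ->
  (forall x, B x -> f x <= c * g x) -> (P B <= c%:E * Q B)%E.
Proof.
move=> c0 [mf f0 Pf] [mg g0 Qg] mB fg.
have mE (u : T -> R) : measurable_fun setT u -> measurable_fun B (EFin \o u).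
  by move=> mu'; apply/measurable_EFinP; exact: measurable_funTS.
rewrite Pf// Qg// -ge0_integralZl_EFin//; last 2 first.
- by move=> x _; rewrite lee_fin.
- exact: mE.
apply: ge0_le_integral => //.
- by move=> x _; rewrite lee_fin.
- exact: mE.
- apply: (mE (fun x => c * g x)); exact: measurable_funM.
Qed.

Lemma identified_measure_le mu P Q f g (c : R) (B : set T) : 0 <= c ->
  identified mu P Q f g -> measurable B ->
  (forall x, B x -> f x <= c * g x) -> (P B <= c%:E * Q B)%E.
Proof.
move=> c0 [] [Pf Qg].
  exact: is_pmf_measure_le c0 Pf Qg.
exact: is_density_measure_le c0 Pf Qg.
Qed.

(** * Measurability and mean of the log-likelihood ratio *)

Lemma measurable_llr mu P Q f g : identified mu P Q f g ->
  measurable_fun setT (llr f g).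
Proof.
move=> fg; have [f0 g0] := identified_ge0 fg.
have mge (s : R) : measurable [set x | (s%:E <= llr f g x)%E].
  rewrite (_ : mkset _ = [set x | 0 < f x] `&` [set x | 2 `^ s * g x <= f x]).
    case: fg => [[Pf _]|[[mf _ _] [mg _ _]]].
      (* In the discrete case the level set lies in the support of [f], hence is countable;
         singletons being events, it is an event. *)
      apply: countable_measurable; first by case: Pf.
      apply: (sub_countable _ (is_pmf_countable_support Pf)).
      by apply: subset_card_le; exact: subIsetl.
    apply: measurableI.
      rewrite -[X in measurable X]setTI -preimage_itvoy.
      by apply: mf.
    rewrite -[X in measurable X]setTI; apply: measurable_fun_le => //.
    exact: measurable_funM.
  by apply/seteqP; split => x /=; rewrite le_llr// => /andP.
move=> _; apply: (measurability _ (ErealGenCInfty.measurableE R)) => //.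
move=> _ [_ [r ->] <-]; rewrite setTI.
rewrite (_ : _ @^-1` _ = [set x | (r%:E <= llr f g x)%E])//.
by apply/seteqP; split => x /=; rewrite in_itv/= andbT.
Qed.

(** Positive parts increase and negative parts decrease, so both nonnegative integrals move the
    right way. This covers [llr], which may take infinite values. *)
Lemma ae_le_integral mu (u v : T -> \bar R) :
  measurable_fun setT u -> measurable_fun setT v ->
  (\forall x \ae mu, (u x <= v x)%E) ->
  (\int[mu]_x u x <= \int[mu]_x v x)%E.
Proof.
move=> mu_ mv uv; rewrite integralE [leRHS]integralE; apply: leeB.
- apply: ae_ge0_le_integral => //; try exact: measurable_funepos.
  apply: filterS uv => x uvx _.
  by rewrite !funeposE ge_max !le_max uvx lexx orbT.
- apply: ae_ge0_le_integral => //; try exact: measurable_funeneg.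
  apply: filterS uv => x uvx _.
  by rewrite !funenegE ge_max !le_max leeN2 uvx lexx orbT.
Qed.

Lemma measurable_typical_set mu P Q f g (D delta : R) :
  identified mu P Q f g -> measurable (typical_set f g D delta).
Proof.
move=> fg; have mllr := measurable_llr fg.
rewrite (_ : typical_set _ _ _ _ =
    (setT `&` [set x | ((D - delta)%:E <= llr f g x)%E]) `&`
    (setT `&` [set x | (llr f g x <= (D + delta)%:E)%E])); last first.
  by rewrite !setTI; apply/seteqP; split => x /= /andP.
apply: measurableI; first exact: emeasurable_fun_c_infty.
exact: emeasurable_fun_infty_c.
Qed.

(* The typical set alone only has error probability [<= tau], which does not
   make it an admissible region.  If the wider lower tail still had probability
   [tau], nothing would be left above [D + delta], and the mean of the
   log-likelihood ratio would be at most [D - tau * delta]. *)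
Lemma llr_lower_tail_lt mu P Q f g (D tau delta : R) :
  identified mu P Q f g -> relative_entropy P f g = D%:E ->
  0 < tau < 1 -> 0 < delta ->
  ((1 - tau)%:E <= P (typical_set f g D delta))%E ->
  (P [set x | (llr f g x < (D - delta / tau)%:E)%E] < tau%:E)%E.
Proof.
move=> fg PD /andP[tau0 tau1] delta0; set A := typical_set _ _ _ _ => PA.
set L := mkset _; rewrite ltNge; apply/negP => PL.
have mllr := measurable_llr fg.
have mA : measurable A by exact: measurable_typical_set fg.
have mL : measurable L.
  by rewrite -[L]setTI; exact: emeasurable_fun_infty_o.
have deltatau : delta < delta / tau by rewrite ltr_pdivlMr// gtr_pMr.
have AL0 : A `&` L = set0.
  apply/seteqP; split => // x [/andP[Ax _] Lx].
  have := le_lt_trans Ax Lx; rewrite lte_fin ltrD2l ltrN2.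
  by rewrite ltNge (ltW deltatau).
have PALC0 : P (~` (A `|` L)) = 0%E.
  apply/eqP; rewrite eq_le measure_ge0 andbT.
  rewrite probability_setC ?measureU//; last exact: measurableU.
  rewrite sube_le0 (le_trans _ (leeD PA PL))//.
  by rewrite -EFinD subrK.
(* [u] is [D - delta / tau] on [L] and [D + delta] elsewhere; it dominates [llr] almost surely
   because [A] and [L] together carry all the mass. *)
pose u x : R := D + delta - (delta + delta / tau) * \1_L x.
have mu_ : measurable_fun setT u.
  apply: measurable_funB => //; exact: measurable_funM.
have llr_le_u : \forall x \ae P, (llr f g x <= (u x)%:E)%E.
  exists (~` (A `|` L)); split => //; first exact/measurableC/measurableU.
  apply: subsetC => x ALx; rewrite /= /u indicE.
  have [Lx|Lx] := boolP (x \in L).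
    rewrite mulr1 opprD addrA addrK.
    by move: Lx; rewrite inE => /ltW.
  rewrite mulr0 subr0; case: ALx => [/andP[]//|].
  by move/mem_set; rewrite (negbTE Lx).
have PLfin : P L \is a fin_num by exact: fin_num_measure.
have intu : (\int[P]_x (u x)%:E =
    (D + delta)%:E - (delta + delta / tau)%:E * P L)%E.
  under eq_integral do rewrite /u EFinB EFinM.
  rewrite integralB//.
  - rewrite integralZl//; last exact: integrable_indic.
    rewrite integral_indic// setIT.
    by rewrite (integral_cst P measurableT)/= probability_setT mule1.
  - exact: (finite_measure_integrable_cst P (D + delta) measurableT).
  - by apply: integrableZl => //; exact: integrable_indic.
have : (D%:E <= \int[P]_x (u x)%:E)%E.
  by rewrite -PD; apply: ae_le_integral => //; exact/measurable_EFinP.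
rewrite intu -(fineK PLfin) -EFinM -EFinB lee_fin.
move: PL; rewrite -(fineK PLfin) lee_fin => tauPL.
have dt0 : 0 < delta / tau by rewrite divr_gt0.
have dtK : delta / tau * tau = delta by rewrite divfK ?gt_eqF.
nra.
Qed.

(** * Bounds on the optimal type-II error for a single pair of laws *)

Lemma optimal_type2_error_le mu P Q f g (D tau delta : R) :
  identified mu P Q f g -> relative_entropy P f g = D%:E ->
  0 < tau < 1 -> 0 < delta ->
  ((1 - tau)%:E <= P (typical_set f g D delta))%E ->
  (optimal_type2_error P Q tau <= (2 `^ (- (D - delta / tau)))%:E)%E.
Proof.
move=> fg PD tau01 delta0 PA.
have [f0 g0] := identified_ge0 fg.
set s := D - delta / tau.
pose B := [set x | (s%:E <= llr f g x)%E].
have mB : measurable B.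
  rewrite -[B]setTI; apply: emeasurable_fun_c_infty => //.
  exact: measurable_llr fg.
have BC : ~` B = [set x | (llr f g x < s%:E)%E].
  by apply/seteqP; split => x /=; rewrite ltNge => /negP.
apply: ge_ereal_inf; exists (Q B).
  by exists B => //; split => //; rewrite BC; exact: llr_lower_tail_lt fg _ _ _ _.
apply: (@le_trans _ _ ((2 `^ (- s))%:E * P B)%E).
  (* The laws exchange roles: on [B] it is [g] that is bounded by a multiple of [f]. *)
  apply: (identified_measure_le _ (identifiedC fg)) => //.
  move=> x; rewrite /B /= le_llr// => /andP[_ gf].
  by rewrite powRN mulrC ler_pdivlMr ?powR_gt0// mulrC.
by rewrite -[leRHS]mule1 lee_wpmul2l ?lee_fin ?powR_ge0// probability_le1.
Qed.

Lemma le_optimal_type2_error mu P Q f g (D tau delta : R) :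
  identified mu P Q f g ->
  ((1 - tau)%:E <= P (typical_set f g D delta))%E ->
  ((2 `^ (- (D + delta)) * (1 - 2 * tau))%:E <= optimal_type2_error P Q tau)%E.
Proof.
move=> fg; set A := typical_set _ _ _ _ => PA.
have [f0 g0] := identified_ge0 fg.
have mA : measurable A by exact: measurable_typical_set fg.
apply/ereal_infP => _ [B [mB PBC] <-].
have mAB : measurable (A `&` B) by exact: measurableI.
have mBC : measurable (~` B) by exact: measurableC.
(* [A] is covered by its part in [B] and the complement of [B], whose mass is below [tau]. *)
have PAB : ((1 - 2 * tau)%:E <= P (A `&` B))%E.
  have PBCfin : P (~` B) \is a fin_num by exact: fin_num_measure.
  have PABfin : P (A `&` B) \is a fin_num by exact: fin_num_measure.
  have : (P A <= P (A `&` B) + P (~` B))%E.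
    apply: (@le_trans _ _ (P ((A `&` B) `|` ~` B))); last exact: measureU2.
    apply: le_measure; rewrite ?inE//; first exact: measurableU.
    by move=> x Ax; have [Bx|Bx] := pselect (B x); [left|right].
  move/(le_trans PA); move: PBC.
  rewrite -(fineK PBCfin) -(fineK PABfin) -EFinD !lee_fin lte_fin.
  lra.
have PQ : (P (A `&` B) <= (2 `^ (D + delta))%:E * Q (A `&` B))%E.
  apply: (identified_measure_le _ fg) => //.
  by move=> x [/andP[_ Ax] _]; exact: llr_le.
apply: (@le_trans _ _ (Q (A `&` B))); last first.
  by apply: le_measure; rewrite ?inE//; exact: subIsetr.
have QABfin : Q (A `&` B) \is a fin_num by exact: fin_num_measure.
move: (le_trans PAB PQ); rewrite -(fineK QABfin) -EFinM !lee_fin => tauQ.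
by rewrite powRN mulrC ler_pdivrMr ?powR_gt0// [leRHS]mulrC.
Qed.

Lemma log2_optimal_type2_error_bounds mu P Q f g (D tau delta : R) :
  identified mu P Q f g -> relative_entropy P f g = D%:E ->
  0 < tau < 1 / 2 -> 0 < delta ->
  ((1 - tau)%:E <= P (typical_set f g D delta))%E ->
  exists2 y : R, (- log2 (optimal_type2_error P Q tau))%E = y%:E &
    D - delta / tau <= y <= D + delta - ln (1 - 2 * tau) / ln 2.
Proof.
move=> fg PD /andP[tau0 tau12] delta0 PA.
have tau01 : 0 < tau < 1 by rewrite tau0/=; lra.
have t0 : 0 < 1 - 2 * tau by lra.
have le := optimal_type2_error_le fg PD tau01 delta0 PA.
have ge := le_optimal_type2_error fg PA.
have bfin : optimal_type2_error P Q tau \is a fin_num.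
  rewrite fin_numE -ltNye -ltey (lt_le_trans (ltNyr _) ge).
  exact: le_lt_trans le (ltry _).
move: le ge; rewrite -(fineK bfin); set b := fine _; rewrite !lee_fin => le ge.
(* Here [tau < 1 / 2] enters: it makes the lower bound positive, so the logarithm is finite. *)
have b0 : 0 < b by rewrite (lt_le_trans _ ge)// mulr_gt0// powR_gt0.
exists (- (ln b / ln 2)); first by rewrite log2_EFin.
have : ln b / ln 2 <= - (D - delta / tau) by rewrite log2_ler.
have : - (D + delta) + ln (1 - 2 * tau) / ln 2 <= ln b / ln 2.
  rewrite -[- _](mulfK (lt0r_neq0 (ln2_gt0 R))) -ln_powR -mulrDl.
  rewrite -lnM ?posrE ?powR_gt0//.
  by rewrite ler_pM2r ?invr_gt0 ?ln2_gt0// ler_ln ?posrE ?mulr_gt0 ?powR_gt0.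
lra.
Qed.

End likelihood_ratio.

(** * Passage to the limit *)

Theorem theorem1 (R : realType) (d : measure_display) (X : measurableType d)
    (lam : {sigma_finite_measure set X -> \bar R})
    (P Q : forall n : nat, probability (n.-tuple X) R)
    (p q : forall n : nat, n.-tuple X -> R)
    (hpq : forall n : nat,
       identified (power_measure lam n) (P n) (Q n) (p n) (q n))
    (D : nat -> R)
    (hD : forall n : nat, relative_entropy (P n) (p n) (q n) = (D n)%:E)
    (tau : R) (htau : 0 < tau < 1 / 2)
    (hDoo : D n @[n --> \oo] --> +oo)
    (hgood : forall xi : R, 0 < xi ->
       exists delta : nat -> R,
         [/\ forall n : nat, 0 < delta n,
             good P (fun n => typical_set (p n) (q n) (D n))
               (fun=> tau) delta
           & \forall n \near \oo, delta n < xi * D n]) :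
  exists2 r : nat -> R, r =o_\oo D &
    \forall n \near \oo,
      (- log2 (optimal_type2_error (P n) (Q n) tau) = (D n + r n)%:E)%E.
Proof.
pose y n := fine (- log2 (optimal_type2_error (P n) (Q n) tau))%E.
exists (fun n => y n - D n); last first.
  (* Any [xi] would do: only the eventual finiteness of the logarithm is wanted, so that [fine]
     loses nothing. *)
  have [delta [delta0 PA _]] := hgood 1 ltr01.
  apply: filterS PA => n PAn.
  have [z zE _] :=
    log2_optimal_type2_error_bounds (hpq n) (hD n) htau (delta0 n) PAn.
  by rewrite /y zE /= subrKC.
have [tau0 tau12] := andP htau.
apply/eqoP => eps eps0.
(* The factor [tau] compensates the division in [delta / tau], leaving at most [eps / 2 * D n]. The
   other half of [eps] absorbs the constant [C], since [D n] tends to infinity. *)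
have [|delta [delta0 PA delta_lt]] := hgood (eps * tau / 2).
  by rewrite divr_gt0// mulr_gt0.
pose C := - (ln (1 - 2 * tau) / ln 2).
have /cvgryPge/(_ (2 * C / eps)) D_ge := hDoo.
near=> n.
have PAn : ((1 - tau)%:E <= P n (typical_set (p n) (q n) (D n) (delta n)))%E.
  by near: n.
have delta_ltn : delta n < eps * tau / 2 * D n by near: n.
have D_gen : 2 * C / eps <= D n by near: n.
have [z zE /andP[z_ge z_le]] :=
  log2_optimal_type2_error_bounds (hpq n) (hD n) htau (delta0 n) PAn.
rewrite /= /y zE /=.
have delta_tau : delta n / tau <= eps / 2 * D n.
  by rewrite ler_pdivrMr//; lra.
have C_le : C <= eps / 2 * D n by move: D_gen; rewrite ler_pdivrMr//; lra.
(* Positivity of [D n] comes from that of [delta n], which lies below a positive multiple of it. *)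
have D0 : 0 < D n.
  rewrite -(pmulr_rgt0 _ (_ : 0 < eps / 2)) ?divr_gt0//.
  by rewrite (lt_le_trans _ delta_tau)// divr_gt0.
have epsD0 : 0 < eps * D n by rewrite mulr_gt0.
rewrite (gtr0_norm D0) ler_norml; apply/andP; split; first lra.
have : eps * tau / 2 * D n <= eps / 2 * D n.
  by rewrite ler_pM2r// ler_pM2r ?invr_gt0// ger_pMr//; lra.
rewrite -/C in z_le; lra.
Unshelve. all: by end_near.
Qed.
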